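(* Let $n,k\geq 1$ be integers. If $X$ is a generic set of $k$ points in $\mathbb{R}^n$, then the following inequalities hold for the uniqueness degree $d(X)$, where $K\subseteq\mathbb{R}^n$ is a compact set with $X\subseteq K$: 1. $d(X)\leq 2(e+1)$, where $e$ is the smallest integer for which the inequality $k\leq\binom{n+e}{e}$ holds. 2. $d(X)\geq\ell$, where $\ell$ is the smallest integer for which the inequality $k\leq\frac{1}{n+1}\binom{n+\ell}{n}$ holds.
   Context: Generic: an algebraic subset of $(\mathbb{R}^n)^k$ is the common zero set of a family of real polynomials. Saying that a generic set $X=\{p_1,\dots,p_k\}$ of $k$ points in $\mathbb{R}^n$ satisfies a property means that there is a proper algebraic subset $Z\subsetneq(\mathbb{R}^n)^k$ such that the property holds for $X=\{p_1,\dots,p_k\}$ (a set of $k$ distinct points) whenever $(p_1,\dots,p_k)\in(\mathbb{R}^n)^k\setminus Z$. Let $V_{\leq d}$ be the vector space of real polynomials in $n$ variables of degree at most $d$; the integers $e$ and $\ell$ are degrees of polynomials, hence range over nonnegative integers. Let $\mathcal{S}(K)$ be the set of all (real-valued) signed Borel measures on $K$, and $\|\nu\|_{\rm TV}:=\sup\{\int_K g\,d\nu : g \text{ continuous on } K,\ \|g\|_\infty\leq 1\}$. A positive discrete measure supported on $X$ is a measure $\mu=\sum_{x\in X}c_x\delta_x$ with all $c_x\geq 0$, where $\delta_x$ is the Dirac measure at $x$. Uniqueness degree: for a finite set $X\subseteq K\subseteq\mathbb{R}^n$, $d(X)$ is the smallest integer $d$ such that for every positive discrete measure $\mu$ supported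 on $X$, the problem $$\min_{\nu\in\mathcal{S}(K)}\|\nu\|_{\rm TV}\quad\text{subject to}\quad \int_K f\,d\nu=\int_K f\,d\mu\ \text{ for all } f\in V_{\leq d}$$ has a unique solution.
   Formalization: Inequality 2 is proved under the added assumption that X lies in the interior of K; for arbitrary compact K containing X it is false (n=1, k=2, K=X gives d(X)≤1 but ℓ=3). Inequality 1 is proved for every compact K containing X. *)

(* Defs.v *)
From HB Require Import structures.
From mathcomp Require Import all_boot all_order all_algebra.
From mathcomp Require Import all_classical all_reals all_analysis.
(* The notations of mpoly clash with those of mathcomp-analysis. *)
From mathcomp Require Import -(notations) mpoly.

Set Implicit Arguments.
Unset Strict Implicit.
Unset Printing Implicit Defensive.

Import Order.TTheory GRing.Theory Num.Theory.
Import numFieldNormedType.Exports.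

Local Open Scope classical_set_scope.
Local Open Scope ring_scope.

Definition is_least (P : nat -> Prop) (m : nat) : Prop :=
  P m /\ forall j : nat, P j -> (m <= j)%N.

Section Genericity.
Variables (R : realType) (n k : nat).

(* A k-tuple of points of R^n is the matrix whose rows are the points; mxvec
   lists its k * n coordinates, in which the polynomials are taken. *)
Definition algebraic_set (Z : set 'M[R]_(k, n)) : Prop :=
  exists F : set (mpoly (k * n) R),
    Z = [set p | forall f, F f -> meval (fun j => mxvec p 0 j) f = 0].

Definition point_set (p : 'M[R]_(k, n)) : set 'rV[R]_n :=
  range (fun i : 'I_k => row i p).

Definition generic (P : 'M[R]_(k, n) -> Prop) : Prop :=
  exists Z : set 'M[R]_(k, n), [/\ algebraic_set Z, Z != setT &
    forall p, ~ Z p -> injective (fun i : 'I_k => row i p) /\ P p].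

End Genericity.

Section UniquenessDegree.
Variables (R : realType) (n : nat).

Definition borelRn := g_sigma_algebraType (@open 'rV[R]_n).

Definition poly_le_deg (d : nat) : set (mpoly n R) :=
  [set f | (msize f <= d.+1)%N].

Definition poly_fun (f : mpoly n R) (x : 'rV[R]_n) : R :=
  meval (fun j => x 0 j) f.

(* S(K) is identified with the charges of R^n concentrated on K. A charge takes
   arbitrary values on non-measurable sets, hence charge_eq below. *)
Definition concentrated (K : set 'rV[R]_n)
    (nu : {charge set borelRn -> \bar R}) : Prop :=
  forall A : set borelRn, measurable A -> nu A = nu (A `&` K).

Definition charge_eq (nu1 nu2 : {charge set borelRn -> \bar R}) : Prop :=
  forall A : set borelRn, measurable A -> nu1 A = nu2 A.

Lemma hahn_pair (nu : {charge set borelRn -> \bar R}) :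
  {PN : set borelRn * set borelRn | hahn_decomposition nu PN.1 PN.2}.
Proof.
by apply: cid; have [P [N PN]] := Hahn_decomposition nu; exists (P, N).
Qed.

(* By uniqueness of the Jordan decomposition, this does not depend on the Hahn
   decomposition that is chosen. *)
Definition charge_integral (nu : {charge set borelRn -> \bar R})
    (K : set 'rV[R]_n) (f : 'rV[R]_n -> R) : R :=
  \int[jordan_pos (svalP (hahn_pair nu))]_(x in (K : set borelRn)) f x -
  \int[jordan_neg (svalP (hahn_pair nu))]_(x in (K : set borelRn)) f x.

Definition tv_norm (K : set 'rV[R]_n)
    (nu : {charge set borelRn -> \bar R}) : \bar R :=
  ereal_sup [set (charge_integral nu K g)%:E | g in
    [set g : 'rV[R]_n -> R |
      {within K, continuous g} /\ forall x, K x -> `|g x| <= 1]].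

Definition positive_discrete (X : set 'rV[R]_n)
    (mu : {measure set borelRn -> \bar R}) : Prop :=
  exists c : 'rV[R]_n -> R, (forall x, X x -> 0 <= c x) /\
    forall A : set borelRn, measurable A ->
      mu A = (\sum_(x \in X) (c x)%:E * \d_(x : borelRn) A)%E.

Definition feasible (K : set 'rV[R]_n) (d : nat)
    (mu : {measure set borelRn -> \bar R})
    (nu : {charge set borelRn -> \bar R}) : Prop :=
  concentrated K nu /\
  forall f, poly_le_deg d f ->
    charge_integral nu K (poly_fun f) =
    \int[mu]_(x in (K : set borelRn)) poly_fun f x.

Definition tv_minimizer (K : set 'rV[R]_n) (d : nat)
    (mu : {measure set borelRn -> \bar R})
    (nu : {charge set borelRn -> \bar R}) : Prop :=
  feasible K d mu nu /\
  forall nu', feasible K d mu nu' -> (tv_norm K nu <= tv_norm K nu')%E.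

Definition has_unique_minimizer (K : set 'rV[R]_n) (d : nat)
    (mu : {measure set borelRn -> \bar R}) : Prop :=
  exists2 nu, tv_minimizer K d mu nu &
    forall nu', tv_minimizer K d mu nu' -> charge_eq nu' nu.

Definition is_uniqueness_degree (K X : set 'rV[R]_n) (d : nat) : Prop :=
  is_least (fun d' => forall mu : {measure set borelRn -> \bar R},
    positive_discrete X mu -> has_unique_minimizer K d' mu) d.

End UniquenessDegree.

(* Main.v *)
Require Import Defs.
From HB Require Import structures.
From mathcomp Require Import all_boot all_order fingroup perm all_algebra.
From mathcomp Require Import all_classical all_reals all_analysis.
From mathcomp Require Import measurable_realfun.
From mathcomp Require Import -(notations) mpoly.
From mathcomp Require Import ring lra.

Import Order.TTheory GRing.Theory Num.Theory.
Import numFieldNormedType.Exports.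

Local Open Scope classical_set_scope.
Local Open Scope ring_scope.

(* Any competitor has the mass of mu, because 1 is a test polynomial; so
   mu itself is a minimizer, and a feasible nu is one iff it is nonnegative.

   Upper bound. Generically the points x_i impose independent conditions in
   degree e: there are q_i of degree at most e with q_i (x_j) = 1 if i = j and 0
   otherwise. The polynomial f = (1 - sum_i q_i)^2 + sum_i |X - x_i|^2 q_i^2 is
   nonnegative of degree at most 2 (e + 1) and vanishes exactly on X. A minimizer
   nu is nonnegative with integral of f equal to 0, hence lives on X, and its
   weights are the integrals of the q_i.

   Lower bound. If d < l, the moments up to degree d of sum_i c_i delta_(x_i) are
   fewer than the k (n + 1) parameters (x, c). Over the polynomial ring their
   Jacobian has a nonzero kernel vector w; following w from a generic (x, c)
   keeps the moments and moves (x, c), which yields other minimizers near mu. *)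

Set Implicit Arguments.
Unset Strict Implicit.
Unset Printing Implicit Defensive.

(** * Multivariate polynomials *)

Lemma fraction_denominator (D : idomainType) (x : {fraction D}) :
  exists2 d : D, d != 0 &
    exists a, @FracField.tofrac D d * x = @FracField.tofrac D a.
Proof.
elim/quotW: x => r; exists (r : D * D).2; first exact: denom_ratioP.
exists (r : D * D).1.
rewrite !piE; apply/eqP; rewrite FracField.equivf_def.
rewrite !numden_Ratio ?oner_eq0 ?mul1r ?mulr1 ?denom_ratioP//.
Qed.

(** Rank over the fraction field yields a kernel vector there, and a common denominator brings it
    back into [D]. Over a polynomial ring this produces a polynomial vector field. *)
Lemma kernel_idomain (D : idomainType) (m n : nat) (A : 'M[D]_(m, n)) :
  (n < m)%N -> exists2 w : 'rV[D]_m, w != 0 & w *m A = 0.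
Proof.
move=> ltnm; pose f := @FracField.tofrac D.
pose B := map_mx f A.
have /rowV0Pn[v /sub_kermxP vB v0] : kermx B != 0.
  by rewrite kermx_eq0 /row_free neq_ltn (leq_ltn_trans (rank_leq_col B) ltnm).
have [d d0 dv] : exists2 d : D, d != 0 & forall j, exists a, f d * v 0 j = f a.
  have [d dP] : exists d : 'I_m -> D, forall j, d j != 0 /\
      exists a, f (d j) * v 0 j = f a.
    apply: (@fin_all_exists _ _ (fun j dj => dj != 0 /\
      exists a, f dj * v 0 j = f a)) => j.
    by have [dj dj0 aP] := fraction_denominator (v 0 j); exists dj.
  exists (\prod_j d j); first by apply/prodf_neq0 => j _; case: (dP j).
  move=> j; have [_ [a aE]] := dP j.
  exists ((\prod_(i | i != j) d i) * a).
  by rewrite (bigD1 j) //= /f !tofracM -/f -aE mulrCA mulrA.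
have [a aP] := fin_all_exists dv.
have fw : map_mx f (\row_j a j) = f d *: v.
  by apply/rowP => j; rewrite !mxE aP.
have finj : injective f by move=> x y /eqP; rewrite tofrac_eq => /eqP.
exists (\row_j a j).
  apply: contraNneq v0 => w0; have : f d *: v == 0.
    by rewrite -fw w0 map_mx0.
  by rewrite scaler_eq0 tofrac_eq0 (negbTE d0).
have fwA : map_mx f ((\row_j a j) *m A) = 0.
  by rewrite /f map_mxM -/f fw -scalemxAl -/B vB scaler0.
apply/matrixP => i j; apply: finj.
by move/matrixP/(_ i j): fwA; rewrite !mxE => ->; rewrite /f tofrac0.
Qed.

(** Uniqueness of base-[B] digits: the lowest digit is the remainder modulo [B], and the quotient
    has one digit fewer. *)
Lemma sum_expn_inj (n B : nat) (a b : 'I_n -> nat) :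
  (forall i, a i < B)%N -> (forall i, b i < B)%N ->
  (\sum_i a i * B ^ i = \sum_i b i * B ^ i)%N -> a =1 b.
Proof.
elim: n a b => [|n IHn] a b aB bB; first by move=> _ [].
have B0 : (0 < B)%N by apply: leq_ltn_trans (aB ord0).
have shift (c : 'I_n.+1 -> nat) : (\sum_i c i * B ^ i =
    (\sum_(i < n) c (lift ord0 i) * B ^ i) * B + c ord0)%N.
  rewrite big_ord_recl expn0 muln1 addnC big_distrl; congr (_ + _)%N.
  by apply: eq_bigr => i _; rewrite /= /bump /= add1n expnSr mulnA.
rewrite !shift => eqS.
have eq0 : a ord0 = b ord0.
  by have := congr1 (modn^~ B) eqS; rewrite !modnMDl !modn_small.
move: eqS; rewrite eq0 => /addIn /eqP; rewrite eqn_pmul2r // => /eqP eqS.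
move=> i; case: (unliftP ord0 i) => [j ->|->] //.
exact: (IHn (fun j => a (lift ord0 j)) (fun j => b (lift ord0 j))).
Qed.

Lemma poly_nonroot_pos (F : numFieldType) (p : {poly F}) :
  p != 0 -> exists2 t : F, 0 < t & p.[t] != 0.
Proof.
(* The candidates 1, ..., [size p] outnumber the roots of [p]. *)
move=> p0; pose s := [seq i.+1%:R : F | i <- iota 0 (size p)].
have us : uniq s.
  rewrite map_inj_uniq ?iota_uniq // => i j /eqP.
  by rewrite eqr_nat => /eqP[].
have [/(max_poly_roots p0)/(_ us)|/allPn[t ts pt]] := boolP (all (root p) s).
  by rewrite size_map size_iota ltnn.
exists t => //; by move/mapP: ts => [i _ ->]; rewrite ltr0Sn.
Qed.

(* Kronecker's substitution x_i = t ^ (B ^ i) maps distinct monomials to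
   distinct powers of t once B exceeds the degree. *)
Lemma mpoly_nonzero_pos (F : numFieldType) (n : nat) (f : mpoly n F) :
  f != 0 -> exists2 v : 'I_n -> F, (forall i, 0 < v i) & meval v f != 0.
Proof.
move=> f0; pose B := msize f.
pose phi (m : multinom n) : nat := (\sum_i m i * B ^ i)%N.
pose P : {poly F} := \sum_(m <- msupp f) mcoeff m f *: 'X^(phi m).
have ltB m i : m \in msupp f -> (m i < B)%N.
  move=> /msize_mdeg_lt; apply: leq_ltn_trans.
  by rewrite mdegE (bigD1 i) //= leq_addr.
have [m0 m0f] : exists m0, m0 \in msupp f.
  have : msupp f != [::] by rewrite msupp_eq0.
  by case: (msupp f) => // m s _; exists m; rewrite mem_head.
have P0 : P != 0.
  apply: contraTneq (m0f) => P0; rewrite mcoeff_msupp negbK.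
  have := congr1 (fun p : {poly F} => p`_(phi m0)) P0; rewrite coef0 coef_sum.
  rewrite (bigD1_seq m0) //= big_seq_cond big1 ?addr0.
    by rewrite coefZ coefXn eqxx mulr1 => ->.
  move=> m /andP[mf mm0]; rewrite coefZ coefXn; case: eqP; rewrite ?mulr0 //.
  move=> eqm; case/eqP: mm0; apply/mnmP; apply: (@sum_expn_inj _ B) => //.
  - by move=> i; apply: ltB.
  - by move=> i; apply: ltB.
have [t t0 Pt] := poly_nonroot_pos P0.
exists (fun i => t ^+ (B ^ i)) => [i|]; first exact: exprn_gt0.
congr (_ != 0): Pt; rewrite mevalE horner_sum; apply: eq_bigr => m _.
rewrite hornerZ hornerXn; congr (_ * _); rewrite /phi.
rewrite -[LHS]prodrXr; apply: eq_bigr => i _.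
by rewrite -exprM mulnC.
Qed.

(** Exponents in a monomial of degree at most [d] are themselves at most [d], so these monomials are
    the tuples over ['I_d.+1] with sum at most [d], which are counted by
    [card_partial_ord_partitions]. *)
Lemma enum_monomials (n d : nat) : exists2 m : 'I_('C(n + d, n)) -> multinom n,
  injective m & forall u, (mdeg u <= d)%N <-> exists a, m a = u.
Proof.
have := card_partial_ord_partitions n d; set S := finset _ => cS.
pose toM (t : n.-tuple 'I_d.+1) := Multinom (map_tuple (@nat_of_ord d.+1) t).
have toME t i : toM t i = tnth t i by rewrite multinomE tnth_map.
have toM_inj : injective toM.
  move=> t u /mnmP tu; apply: eq_from_tnth => i; apply: ord_inj.
  by rewrite -!toME.
have degM t : mdeg (toM t) = (\sum_(i <- t) i)%N.
  rewrite mdegE big_tuple; apply: eq_bigr => i _; exact: toME.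
exists (fun a => toM (enum_val (cast_ord (esym cS) a))).
  by move=> a b /toM_inj /enum_val_inj /cast_ord_inj.
move=> u; split=> [du|[a <-]]; last first.
  rewrite degM; have := enum_valP (cast_ord (esym cS) a).
  by rewrite inE.
have ltu i : (u i < d.+1)%N.
  by rewrite ltnS (leq_trans _ du) // mdegE (bigD1 i) //= leq_addr.
pose t : n.-tuple 'I_d.+1 := [tuple Ordinal (ltu i) | i < n].
have tu : toM t = u by apply/mnmP => i; rewrite toME tnth_mktuple.
have tS : t \in S by rewrite inE -degM tu.
exists (cast_ord cS (enum_rank_in tS t)).
by rewrite cast_ordK enum_rankK_in.
Qed.

(** A generalized Vandermonde determinant as a polynomial in all coordinates. The Leibniz term of a
    permutation [s] carries the exponent [m (s i)] in the variables of the i-th point; since [m] is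
    injective, distinct terms have distinct monomials and nothing cancels. *)
Lemma unisolvent_det (R : comNzRingType) (k n : nat) (m : 'I_k -> multinom n) :
  injective m -> exists2 D : mpoly (k * n) R, D != 0 &
    forall p : 'M[R]_(k, n), meval (fun l => mxvec p 0 l) D =
      \det (\matrix_(i, j) meval (fun l => p i l) (mpolyX R (m j))).
Proof.
move=> minj.
pose block (u : 'I_k -> multinom n) : multinom (k * n) :=
  Multinom [tuple mxvec (\matrix_(i, j) (u i j)) 0 l | l < k * n].
have blockE u i j : block u (mxvec_index i j) = u i j.
  by rewrite multinomE tnth_mktuple mxvecE mxE.
have block_inj u v : block u = block v -> u =1 v.
  by move=> uv i; apply/mnmP => j; rewrite -!blockE uv.
have evalE u (p : 'M[R]_(k, n)) :
    meval (fun l => mxvec p 0 l) (mpolyX R (block u)) =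
    \prod_i meval (fun l => p i l) (mpolyX R (u i)).
  rewrite mevalX (reindex _ (curry_mxvec_bij _ _)) /=.
  under [RHS]eq_bigr do rewrite mevalX.
  by rewrite pair_bigA /=; apply: eq_bigr => -[i j] _ /=; rewrite mxvecE blockE.
exists (\sum_(s : 'S_k) (-1) ^+ s *: mpolyX R (block (m \o s))).
  (* The coefficient at the monomial of the identity permutation is 1. *)
  apply: contra_neq (oner_neq0 R) => D0.
  have := congr1 (mcoeff (block m)) D0.
  rewrite raddf_sum (bigD1 1%g) //= big1 => [|s s1].
    rewrite odd_perm1 expr0 scale1r mcoeffX mcoeff0 addr0.
    suff -> : block (m \o (1%g : 'S_k)) = block m by rewrite eqxx.
    by congr Multinom; apply: eq_from_tnth => l; rewrite !tnth_mktuple;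
       congr (mxvec _ _ _); apply/matrixP => i j; rewrite !mxE /= perm1.
  rewrite mcoeffZ mcoeffX; case: eqP; rewrite ?mulr0 // => /block_inj eqm.
  exfalso; case/eqP: s1; apply/permP => i; apply: minj.
  by rewrite perm1; exact: eqm.
move=> p; rewrite raddf_sum; apply: eq_bigr => s _ /=.
rewrite mevalZ evalE; congr (_ * _); apply: eq_bigr => i _.
by rewrite mxE.
Qed.

(** Makes a moment polynomial in points and weights jointly: the first [k * n] variables are the
    coordinates, the last [k] the weights. *)
Lemma weighted_power_sum (R : comNzRingType) (k n : nat) (f : mpoly n R) :
  exists F : mpoly (k * n + k) R, forall (p : 'M[R]_(k, n)) (c : 'rV[R]_k),
    meval (fun l => row_mx (mxvec p) c 0 l) F =
    \sum_i c 0 i * meval (fun j => p i j) f.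
Proof.
exists (\sum_i mpolyX R (mnm1 (rshift (k * n) i)) *
  comp_mpoly [tuple mpolyX R (mnm1 (lshift k (mxvec_index i j))) | j < n] f).
move=> p c; rewrite raddf_sum; apply: eq_bigr => i _ /=.
rewrite mevalM mevalXU row_mxEr comp_mpoly_meval; congr (_ * _).
apply: meval_eq => j; rewrite tnth_mktuple mevalXU row_mxEl.
exact: mxvecE.
Qed.

(** Genericity may constrain the points only, whereas [W] will also involve weights. A positive
    point where [W] is nonzero supplies the weights to freeze, and its remaining coordinates witness
    that the specialized polynomial is nonzero. *)
Lemma specialize_last (R : numFieldType) (a b : nat) (W : mpoly (a + b) R) :
  W != 0 -> exists (c : 'rV[R]_b) (D : mpoly a R),
   [/\ forall i, 0 < c 0 i, D != 0 & forall p : 'rV[R]_a,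
    meval (fun l => p 0 l) D = meval (fun l => row_mx p c 0 l) W].
Proof.
move=> /mpoly_nonzero_pos[v v0 Wv].
pose c : 'rV[R]_b := \row_i v (rshift a i).
pose t := [tuple match fintype.split l with inl i => mpolyX R (mnm1 i)
                               | inr i => mpolyC a (c 0 i) end | l < a + b].
have DE (p : 'rV[R]_a) : meval (fun l => p 0 l) (comp_mpoly t W) =
    meval (fun l => row_mx p c 0 l) W.
  rewrite comp_mpoly_meval; apply: meval_eq => l; rewrite tnth_mktuple mxE.
  by case: (fintype.split l) => i; rewrite ?mevalXU ?mevalC.
exists c, (comp_mpoly t W); split => // [i|]; first by rewrite mxE.
apply: contraNneq Wv => D0; have := DE (\row_i v (lshift b i)).
rewrite D0 meval0 => /esym; rewrite (meval_eq (v2 := v)) => [->//|l].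
by rewrite -[l]fintype.splitK; case: (fintype.split l) => i /=; rewrite ?row_mxEl ?row_mxEr mxE.
Qed.

(** * Fibers of polynomial maps *)

Lemma mpoly_ring_ind (R : nzRingType) (n : nat) (P : mpoly n R -> Prop) :
  (forall c, P (mpolyC n c)) -> (forall i, P (mpolyX R (mnm1 i))) ->
  (forall f g, P f -> P g -> P (f + g)) ->
  (forall f g, P f -> P g -> P (f * g)) -> forall f, P f.
Proof.
move=> PC PX PD PM f; rewrite (mpolyE f).
apply: big_ind => [||m _]; [by rewrite -(mpolyC0 n R)|exact: PD|].
rewrite -mul_mpolyC; apply: (PM) => //; rewrite mpolyXE_id.
apply: big_ind => [||i _]; [by rewrite -(mpolyC1 n R)|exact: PM|].
by elim: (m i) => [|k IHk]; rewrite ?expr0 -?(mpolyC1 n R) // exprS; apply: (PM).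
Qed.

Lemma meval_continuous (R : realType) (n : nat) (f : mpoly n R) :
  continuous (fun z : 'rV[R]_n => meval (fun l => z 0 l) f).
Proof.
pose ev g := fun z : 'rV[R]_n => meval (fun l => z 0 l) g.
rewrite -/(ev f); elim/mpoly_ring_ind: f => [c|i|f g cf cg|f g cf cg].
- have -> : ev (mpolyC n c) = cst c by apply/funext => z; exact: mevalC.
  exact: cst_continuous.
- have -> : ev (mpolyX R (mnm1 i)) = fun z => z 0 i.
    by apply/funext => z; exact: mevalXU.
  exact: coord_continuous.
- have -> : ev (f + g) = ev f \+ ev g by apply/funext => z; exact: mevalD.
  by move=> z; apply: continuousD; [exact: cf|exact: cg].
- have -> : ev (f * g) = ev f \* ev g by apply/funext => z; exact: mevalM.
  by move=> z; apply: continuousM; [exact: cf|exact: cg].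
Qed.

Section VectorField.
Variables (R : realType) (M : nat) (w : 'I_M -> mpoly M R).

Definition vfield (z : 'rV[R]_M) : 'rV[R]_M :=
  \row_l meval (fun j => z 0 j) (w l).

Definition lie_derivative (f : mpoly M R) : mpoly M R := \sum_l w l * mderiv l f.

(** Continuity of the remainder jointly in the step and the base point is what later bounds it
    uniformly on compact sets. *)
Lemma vfield_taylor (f : mpoly M R) :
  exists2 G : R * 'rV[R]_M -> R, continuous G & forall h z,
    meval (fun l => (z + h *: vfield z) 0 l) f =
    meval (fun l => z 0 l) f + h * meval (fun l => z 0 l) (lie_derivative f) +
      h ^+ 2 * G (h, z).
Proof.
pose ev g := fun x : R * 'rV[R]_M => meval (fun l => x.2 0 l) g.
have evc (g : mpoly M R) : continuous (ev g).
  move=> x; apply: (@continuous_comp _ _ _ snd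
    (fun z : 'rV[R]_M => meval (fun l => z 0 l) g)); first exact: cvg_snd.
  exact: meval_continuous.
have fstc : continuous (fst : R * 'rV[R]_M -> R) by move=> x; exact: cvg_fst.
elim/mpoly_ring_ind: f => [c|i|f g [F cF Ff] [G cG Gg]|f g [F cF Ff] [G cG Gg]].
- exists (fun=> 0) => [x|h z]; first exact: cvg_cst.
  rewrite /lie_derivative big1 => [|l _]; last by rewrite mderivC mulr0.
  by rewrite !mevalC; ring.
- exists (fun=> 0) => [x|h z]; first exact: cvg_cst.
  rewrite /lie_derivative (bigD1 i) //= big1 => [|l li]; last first.
    by rewrite mderivX mnm1E eq_sym (negbTE li) scale0r mulr0.
  rewrite mderivX mnm1E eqxx scale1r addr0 !mevalXU mevalM.
  rewrite (_ : mpolyX R _ = 1); last first.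
    by rewrite -mpolyX0; congr mpolyX; apply/mnmP => j; rewrite mnmBE subnn mnmE.
  by rewrite meval1 !mxE; ring.
- exists (F \+ G) => [x|h z]; first by apply: continuousD; [exact: cF|exact: cG].
  have -> : lie_derivative (f + g) = lie_derivative f + lie_derivative g.
    rewrite /lie_derivative -big_split; apply: eq_bigr => l _ /=.
    by rewrite mderivD mulrDr.
  by rewrite !mevalD Ff Gg /=; ring.
(* The terms of order at least two in [h] in the product of both expansions, divided by [h ^+ 2]. *)
- exists (ev f \* G \+ ev g \* F \+ ev (lie_derivative f) \* ev (lie_derivative g) \+
    fst \* (ev (lie_derivative f) \* G \+ ev (lie_derivative g) \* F) \+
    fst \* fst \* F \* G) => [x|h z].
    have cfx := evc f x; have cgx := evc g x.
    have cDfx := evc (lie_derivative f) x; have cDgx := evc (lie_derivative g) x.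
    have cFx := cF x; have cGx := cG x; have c1 := fstc x.
    by do ?[exact | apply: continuousD | apply: continuousM].
  have -> : lie_derivative (f * g) = lie_derivative f * g + f * lie_derivative g.
    rewrite /lie_derivative big_distrl big_distrr -big_split.
    by apply: eq_bigr => l _ /=; rewrite mderivM; ring.
  by rewrite !(mevalD, mevalM) Ff Gg /=; ring.
Qed.

End VectorField.

Lemma continuous_compact_bounded (R : realType) (T : topologicalType)
    (A : set T) (f : T -> R) : compact A -> {within A, continuous f} ->
  exists2 C, 0 < C & forall x, A x -> `|f x| <= C.
Proof.
move=> cA cf; have [C [_ fC]] := compact_bounded (continuous_compact cf cA).
exists (`|C| + 1); first by rewrite ltr_wpDl.
by move=> x Ax; apply: fC; [rewrite ltr_pwDr // ler_norm|exists x].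
Qed.

Lemma rV_norm_le (R : realType) (n : nat) (v : 'rV[R]_n) (b : R) :
  0 <= b -> (forall l, `|v 0 l| <= b) -> `|v| <= b.
Proof.
move=> b0 vb; rewrite /Num.norm /= mx_normrE; apply: bigmax_le => // -[i l] _ /=.
by rewrite ord1.
Qed.

Lemma rV_norm_ge (R : realType) (n : nat) (v : 'rV[R]_n) l : `|v 0 l| <= `|v|.
Proof.
rewrite [leRHS]/Num.norm /= mx_normrE; apply/bigmax_geP; right => /=.
by exists (0, l).
Qed.

Lemma rV_closed_ball_compact (R : realType) (n : nat) (z : 'rV[R]_n) (r : R) :
  0 < r -> compact (closed_ball z r).
Proof.
move=> r0; apply: bounded_closed_compact; last exact: closed_ball_closed.
exists (`|z| + r); split; first by rewrite num_real.
move=> b ltb x; rewrite closed_ballE // => zx; apply: ltW; apply: le_lt_trans ltb.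
rewrite -[x](subKr z) (le_trans (ler_normB _ _)) // lerD2l.
exact: zx.
Qed.

(* Euler polygons along w with step T / m displace z0 by at least T * eta in
   the coordinate l0 while they change f by O(1 / m) only. *)
Lemma fiber_along_vfield (R : realType) (M N : nat) (w : 'I_M -> mpoly M R)
    (f : 'I_N -> mpoly M R) (z0 : 'rV[R]_M) (l0 : 'I_M) (U : set 'rV[R]_M) :
  (forall a, lie_derivative w (f a) = 0) ->
  0 < meval (fun l => z0 0 l) (w l0) -> nbhs z0 U ->
  exists z, [/\ U z, z != z0 &
    forall a, meval (fun l => z 0 l) (f a) = meval (fun l => z0 0 l) (f a)].
Proof.
move=> wf; set eta2 := meval _ _ => eta2_gt0 z0U.
pose ev g (z : 'rV[R]_M) := meval (fun l => z 0 l) g.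
pose eta := eta2 / 2; have eta0 : 0 < eta by rewrite divr_gt0.
(* On a small ball inside [U] the field keeps speed above [eta] in the coordinate [l0]. *)
have [r r0 Sr] : exists2 r, 0 < r & closed_ball z0 r `<=`
    U `&` [set z | eta < ev (w l0) z].
  have : nbhs z0 (U `&` [set z | eta < ev (w l0) z]).
    apply: filterI => //.
    have /cvgr_gt := @meval_continuous R M (w l0) z0; apply.
    by rewrite /eta -/eta2; lra.
  by move=> /nbhs_closedballP[r rS]; exists r%:num.
pose S0 := closed_ball z0 r.
have S0E z : S0 z <-> `|z - z0| <= r by rewrite /S0 closed_ballE //= distrC.
have cS0 : compact S0 by exact: rV_closed_ball_compact.
have [B B0 wB] : exists2 B, 0 < B & forall z, S0 z -> `|vfield w z| <= B.
  have /fin_all_exists[b bP] l : exists b, 0 < b /\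
      forall z, S0 z -> `|ev (w l) z| <= b.
    have [] := @continuous_compact_bounded R _ S0 (ev (w l)) cS0.
      by apply: continuous_subspaceT; exact: meval_continuous.
    by move=> b; exists b.
  exists (1 + \sum_l b l).
    by rewrite ltr_pwDl // sumr_ge0 // => l _; case: (bP l) => /ltW.
  have b0 l : 0 <= b l by case: (bP l) => /ltW.
  move=> z zS; apply: rV_norm_le => [|l].
    by rewrite addr_ge0 // sumr_ge0.
  rewrite mxE; have [_ /(_ z zS)/le_trans] := bP l; apply.
  by rewrite (bigD1 l) //= addrCA lerDl addr_ge0 // sumr_ge0.
(* The derivative of [f a] along [w] is zero, so an Euler step changes [f a] to second order
   only. *)
have [G GP] : exists G : 'I_N -> R * 'rV[R]_M -> R, forall a, continuous (G a) /\
    forall h z, ev (f a) (z + h *: vfield w z) = ev (f a) z + h ^+ 2 * G a (h, z).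
  apply: (@fin_all_exists _ _ (fun a g => continuous g /\ forall h z,
    ev (f a) (z + h *: vfield w z) = ev (f a) z + h ^+ 2 * g (h, z))) => a.
  have [g cg gP] := vfield_taylor w (f a); exists g; split=> // h z.
  by rewrite /ev gP wf meval0 mulr0 addr0.
have [C CP] : exists C : 'I_N -> R, forall a, 0 < C a /\
    forall h z, 0 <= h <= 1 -> S0 z -> `|G a (h, z)| <= C a.
  apply: (@fin_all_exists _ _ (fun a c => 0 < c /\
    forall h z, 0 <= h <= 1 -> S0 z -> `|G a (h, z)| <= c)) => a.
  pose I01 : set R := `[0, 1]%classic.
  have [] := @continuous_compact_bounded R _ (I01 `*` S0) (G a).
  - by apply: compact_setX => //; exact: segment_compact.
  - by apply: continuous_subspaceT; case: (GP a).
  - by move=> c c0 cP; exists c; split=> // h z h01 zS; apply: cP; split.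
(* Up to time [T] a polygon of speed at most [B] stays in the ball of radius [r]; [T <= 1] keeps
   every step in the range where [C] bounds the remainders. *)
pose T := Num.min 1 (r / B).
have T0 : 0 < T by rewrite lt_min ltr01 divr_gt0.
have TB : T * B <= r by rewrite -ler_pdivlMr // ge_min lexx orbT.
have T1 : T <= 1 by rewrite ge_min lexx.
pose zz (m j : nat) := iter j (fun z => z + (T / m%:R) *: vfield w z) z0.
have zzP (m j : nat) : (0 < m)%N -> (j <= m)%N -> let h := T / m%:R in
    [/\ `|zz m j - z0| <= j%:R * h * B, j%:R * h * eta <= (zz m j - z0) 0 l0 &
      forall a, `|ev (f a) (zz m j) - ev (f a) z0| <= j%:R * h ^+ 2 * C a].
  move=> m0 jm h; have h0 : 0 <= h by rewrite divr_ge0 // ltW.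
  have mh : m%:R * h = T by rewrite /h mulrC divfK // pnatr_eq0 -lt0n.
  have h1 : h <= 1.
    apply: le_trans T1; rewrite -mh ler_peMl //.
    by rewrite ler1n.
  elim: j jm => [_|j IHj jm].
    rewrite /zz /= subrr normr0 !mul0r mxE; split=> // a.
    by rewrite subrr normr0 !mul0r.
  have [IH1 IH2 IH3] := IHj (ltnW jm).
  have zS : S0 (zz m j).
    apply/S0E; apply: le_trans IH1 _; apply: le_trans TB.
    apply: ler_wpM2r; first exact: ltW.
    by rewrite -mh; apply: ler_wpM2r => //; rewrite ler_nat ltnW.
  have zzS : zz m j.+1 = zz m j + h *: vfield w (zz m j) by [].
  have zzB : zz m j.+1 - z0 = (zz m j - z0) + h *: vfield w (zz m j).
    by rewrite zzS addrAC.
  rewrite -natr1 !mulrDl !mul1r; split.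
  - rewrite zzB (le_trans (ler_normD _ _)) // lerD // normrZ ger0_norm //.
    by rewrite ler_wpM2l // wB.
  - rewrite zzB [leRHS]mxE lerD // mxE ler_wpM2l // mxE.
    by have [_ /ltW] := Sr _ zS.
  - move=> a; rewrite zzS; have [_ ->] := GP a.
    rewrite addrAC (le_trans (ler_normD _ _)) // mulrDl lerD // normrM.
    rewrite ger0_norm ?exprn_ge0 // ler_wpM2l ?exprn_ge0 //.
    by have [_] := CP a; apply => //; rewrite h0.
(* Instead of passing to a limit of polygons, the total deviation of [f] is minimized over this
   compact set, which contains all their endpoints but not [z0]. *)
pose S := S0 `&` [set z : 'rV[R]_M | T * eta <= z 0 l0 - z0 0 l0].
have zzm m : (0 < m)%N -> S (zz m m) /\
    forall a, `|ev (f a) (zz m m) - ev (f a) z0| <= T ^+ 2 * C a / m%:R.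
  move=> m0; have [H1 H2 H3] := zzP m m m0 (leqnn m).
  have m1 : m%:R != 0 :> R by rewrite pnatr_eq0 -lt0n.
  have mT : m%:R * (T / m%:R) = T by rewrite mulrC divfK.
  split; first split.
  - by apply/S0E; rewrite (le_trans H1) // mT.
  - by move: H2; rewrite mT !mxE.
  - move=> a; apply: le_trans (H3 a) _; rewrite le_eqVlt; apply/orP; left.
    by apply/eqP; field.
have cS : compact S.
  apply: subclosed_compact cS0 _; last by move=> ? [].
  apply: closedI; first exact: closed_ball_closed.
  have -> : [set z : 'rV[R]_M | T * eta <= z 0 l0 - z0 0 l0] =
      (fun z : 'rV[R]_M => z 0 l0) @^-1` [set x | T * eta + z0 0 l0 <= x].
    by apply/seteqP; split=> z /=; rewrite lerBrDr.
  apply: closed_comp; last exact: closed_ge.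
  by move=> z _; exact: coord_continuous.
pose phi z := \sum_a `|ev (f a) z - ev (f a) z0|.
have cphi : continuous phi.
  have -> : phi = \sum_a (fun z => `|ev (f a) z - ev (f a) z0|).
    by apply/funext => z; rewrite fct_sumE.
  apply: (@big_ind _ (fun g : 'rV[R]_M -> R => continuous g)).
  - exact: cst_continuous.
  - by move=> g1 g2 c1 c2 z; apply: continuousD; [exact: c1|exact: c2].
  - move=> a _ z; apply: (@continuous_comp _ _ _ (ev (f a) \- cst (ev (f a) z0))
      (fun x : R => `|x|)); last exact: norm_continuous.
    by apply: continuousB; [exact: meval_continuous|exact: cst_continuous].
have [z /set_mem zS zmin] : exists2 z, z \in S &
    forall y, y \in S -> phi z <= phi y.
  apply: compact_EVT_min => //; last exact: continuous_subspaceT.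
  by exists (zz 1%N 1%N); case: (zzm 1%N isT).
(* The polygon with [m.+1] steps bounds the minimum by [D / m.+1%:R], for every [m]. *)
have phi0 : phi z = 0.
  apply/eqP; rewrite eq_le sumr_ge0 // andbT.
  pose D := T ^+ 2 * \sum_a C a.
  have phim m : phi z <= D / m.+1%:R.
    have [zmS zmP] := zzm m.+1 isT; apply: le_trans (zmin _ (mem_set zmS)) _.
    rewrite /D mulr_sumr mulr_suml; apply: ler_sum => a _; exact: zmP.
  rewrite leNgt; apply/negP => phi0.
  have D0 : 0 < D.
    by have := phim 0%N; rewrite divr1; exact: lt_le_trans.
  have [m mP] : exists m : nat, D / m.+1%:R < phi z.
    have [m] := ltr_add_invr (divr_gt0 phi0 D0).
    rewrite add0r ltr_pdivlMr // mulrC => mP.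
    by exists m.
  by have := phim m; rewrite leNgt mP.
exists z; case: zS => zS0 zT; split.
- by case: (Sr _ zS0).
- apply: contraTneq zT => ->; rewrite /= subrr -ltNge; exact: mulr_gt0.
- move=> a; apply/eqP; rewrite -subr_eq0 -normr_eq0; apply/eqP.
  have := phi0; rewrite /phi => /eqP; rewrite psumr_eq0 // => /allP/(_ a).
  by rewrite mem_index_enum => /(_ isT)/eqP.
Qed.

(** The Jacobian matrix has more rows than columns, hence a nonzero polynomial kernel vector: a
    vector field along which every [f a] has derivative zero. One nonzero component of it serves as
    [W]. *)
Lemma generic_fiber_not_isolated (R : realType) (M N : nat)
    (f : 'I_N -> mpoly M R) : (N < M)%N ->
  exists2 W : mpoly M R, W != 0 & forall z0 : 'rV[R]_M,
    meval (fun l => z0 0 l) W != 0 -> forall U, nbhs z0 U ->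
    exists z, [/\ U z, z != z0 &
      forall a, meval (fun l => z 0 l) (f a) = meval (fun l => z0 0 l) (f a)].
Proof.
move=> ltNM.
have [w w0 wA] := kernel_idomain (\matrix_(l, a) mderiv l (f a)) ltNM.
have /rV0Pn[l0 wl0] := w0.
exists (w 0 l0) => // z0 Wz0 U z0U.
set s := meval _ _ in Wz0.
(* Scaling by the constant [s] turns the component [l0] at [z0] into [s ^+ 2], positive whatever the
   sign of [s]. *)
apply: (@fiber_along_vfield _ _ _ (fun l => s *: w 0 l) _ _ l0) => // [a|].
  rewrite /lie_derivative; under eq_bigr do rewrite -scalerAl.
  rewrite -scaler_sumr; have /rowP/(_ a) := wA; rewrite !mxE.
  by under eq_bigr do rewrite mxE; move=> ->; rewrite scaler0.
by rewrite mevalZ -/s -expr2 exprn_even_gt0.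
Qed.

(** * Integration against charges on a compact set *)

Lemma continuous_scale (R : realType) (S : topologicalType) (r : R)
  (g : S -> R) : continuous g -> continuous (fun x => r * g x).
Proof.
move=> cg x; apply: (@continuousM _ _ (cst r)); last exact: cg.
exact: cst_continuous.
Qed.

Lemma continuous_add (R : realType) (S : topologicalType) (g1 g2 : S -> R) :
  continuous g1 -> continuous g2 -> continuous (fun x => g1 x + g2 x).
Proof. by move=> c1 c2 x; apply: continuousD; [exact: c1|exact: c2]. Qed.

Section BorelRn.
Variables (R : realType) (n : nat).
Local Notation T := (borelRn R n).
Implicit Types (K C : set 'rV[R]_n) (g : 'rV[R]_n -> R).

Lemma borel_open (U : set 'rV[R]_n) : open U -> measurable (U : set T).
Proof. exact: sub_sigma_algebra. Qed.

Lemma borel_closed C : closed C -> measurable (C : set T).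
Proof.
move=> cC; rewrite -[C]setCK; apply: measurableC.
by apply: borel_open; exact: closed_openC.
Qed.

Lemma borel_compact K : compact K -> measurable (K : set T).
Proof. by move=> cK; apply: borel_closed; apply: compact_closed. Qed.

Lemma borel_set1 (x : 'rV[R]_n) : measurable ([set x] : set T).
Proof.
by apply: borel_closed; apply: compact_closed => //; exact: compact_set1.
Qed.

Lemma within_continuous_measurable K g : compact K ->
  {within K, continuous g} -> measurable_fun (K : set T) (g : T -> R).
Proof.
move=> cK /continuousP cg.
apply: (measurability _ (RGenOpens.measurableE R)).
move=> _ [_ [a [b ->] <-]].
have /open_subspaceP[V oV VK] := cg _ (@interval_open _ (BSide false a) (BSide true b) isT isT).
have -> : (K : set T) `&` (g : T -> R) @^-1` `]a, b[ = V `&` K.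
  by rewrite VK setIC.
by apply: measurableI; [exact: borel_open|exact: borel_compact].
Qed.

Section FiniteMeasure.
Variable mu : {finite_measure set T -> \bar R}.

Lemma within_continuous_integrable K g : compact K ->
  {within K, continuous g} -> mu.-integrable (K : set T) (EFin \o g).
Proof.
move=> cK cg; apply: measurable_bounded_integrable.
- exact: borel_compact.
- by rewrite ltey_eq fin_num_measure //; exact: borel_compact.
- exact: within_continuous_measurable.
- have [C C0 gC] := continuous_compact_bounded cK cg.
  by exists C; split=> [|B CB x Kx]; [exact: num_real|apply: le_trans (gC x Kx) (ltW CB)].
Qed.

(** Dominated convergence with a constant bound, integrable because the measure is finite. The limit
    may be discontinuous, so indicators of closed sets are allowed. *)
Lemma Rintegral_cvg_eventually K (h_ : nat -> 'rV[R]_n -> R) (h : 'rV[R]_n -> R) (B : R) :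
  compact K -> (forall m, continuous (h_ m)) ->
  (forall m x, K x -> `|h_ m x| <= B) ->
  (forall x, K x -> \forall m \near \oo, h_ m x = h x) ->
  (\int[mu]_(x in (K : set T)) h_ m x) @[m --> \oo] -->
  \int[mu]_(x in (K : set T)) h x.
Proof.
move=> cK ch hB hh.
have mK := borel_compact cK.
have mh m : measurable_fun (K : set T) (fun x : T => (h_ m x)%:E).
  apply/measurable_EFinP; apply: within_continuous_measurable => //.
  exact: continuous_subspaceT.
have hcvg (x : T) : K x -> (h_ m x)%:E @[m --> \oo] --> (h x)%:E.
  move=> Kx; apply: cvg_EFin.
    by apply: nearW.
  by apply: cvg_near_cst; exact: hh.
have iB : mu.-integrable (K : set T) (cst B%:E).
  apply: (@within_continuous_integrable K (cst B)) => //.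
  by apply: continuous_subspaceT; exact: cst_continuous.
have hB' m (x : T) : K x -> (`|(h_ m x)%:E| <= cst B%:E x)%E.
  by move=> Kx; rewrite lee_fin; exact: hB.
have mhl : measurable_fun (K : set T) (fun x : T => (h x)%:E).
  exact: (emeasurable_fun_cvg _ _ mh hcvg).
have [ih _ cv] := dominated_convergence mK mh mhl (aeW _ (fun x Kx => hcvg x Kx))
  iB (aeW _ (fun x m Kx => hB' m x Kx)).
rewrite /Rintegral; apply: fine_cvg.
by rewrite fineK //; exact: integrable_fin_num.
Qed.

End FiniteMeasure.

Lemma eq_charge_integral (nu : {charge set T -> \bar R}) K g1 g2 :
  (forall x, K x -> g1 x = g2 x) ->
  charge_integral nu K g1 = charge_integral nu K g2.
Proof.
by move=> g12; rewrite /charge_integral; congr (_ - _); apply: eq_Rintegral => x;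
  rewrite inE => Kx; exact: g12.
Qed.

Section ChargeIntegral.
Variables (nu : {charge set T -> \bar R}) (K : set 'rV[R]_n).
Hypothesis cK : compact K.
Local Notation I := (charge_integral nu K).

Lemma charge_integralD g1 g2 : {within K, continuous g1} ->
  {within K, continuous g2} -> I (fun x => g1 x + g2 x) = I g1 + I g2.
Proof.
move=> c1 c2; have mK := borel_compact cK.
rewrite /charge_integral !RintegralD //; try exact: within_continuous_integrable.
ring.
Qed.

Lemma charge_integralZ r g : {within K, continuous g} ->
  I (fun x => r * g x) = r * I g.
Proof.
move=> c; have mK := borel_compact cK.
rewrite /charge_integral !RintegralZl //; try exact: within_continuous_integrable.
ring.
Qed.

Lemma charge_integral_cvg (h_ : nat -> 'rV[R]_n -> R) (h : 'rV[R]_n -> R) (B : R) :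
  (forall m, continuous (h_ m)) -> (forall m x, K x -> `|h_ m x| <= B) ->
  (forall x, K x -> \forall m \near \oo, h_ m x = h x) ->
  I (h_ m) @[m --> \oo] --> I h.
Proof.
move=> ch hB hh; rewrite /charge_integral.
apply: (@cvgB _ R^o).
  exact: (@Rintegral_cvg_eventually (jordan_pos _) _ _ _ _ cK ch hB hh).
exact: (@Rintegral_cvg_eventually (jordan_neg _) _ _ _ _ cK ch hB hh).
Qed.

(** If [C] bounds [g] on [K], then 1 - g / C has values in [0, 1] there. It is thus admissible in
    the total variation, and its integral is at most that of 1. *)
Lemma charge_integral_ge0 g : (tv_norm K nu <= (I (cst 1))%:E)%E ->
  continuous g -> (forall x, K x -> 0 <= g x) -> 0 <= I g.
Proof.
move=> tvI cg g0; have cwg : {within K, continuous g} by exact: continuous_subspaceT.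
have [C C0 gC] := continuous_compact_bounded cK cwg.
have c1 : {within K, continuous (cst 1 : 'rV[R]_n -> R)}.
  by apply: continuous_subspaceT; exact: cst_continuous.
have cCg : {within K, continuous (fun x => - C^-1 * g x)}.
  by apply: continuous_subspaceT; exact: continuous_scale.
have : I (fun x => 1 + - C^-1 * g x) <= I (cst 1).
  rewrite -lee_fin; apply: le_trans tvI; apply: ereal_sup_ubound.
  exists (fun x => 1 + - C^-1 * g x) => //; split.
    apply: continuous_subspaceT; apply: continuous_add; first exact: cst_continuous.
    exact: continuous_scale.
  move=> x Kx; have gx0 := g0 x Kx; have := gC x Kx; rewrite ger0_norm // => gxC.
  have : 0 <= C^-1 * g x <= 1.
    apply/andP; split; first by rewrite mulr_ge0 // invr_ge0 ltW.
    by rewrite mulrC ler_pdivrMr // mul1r.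
  by rewrite ler_norml mulNr => /andP[? ?]; lra.
rewrite charge_integralD // charge_integralZ // gerDl mulNr oppr_le0.
by rewrite pmulr_rge0 // invr_gt0.
Qed.

(** The truncation min(m f, g) lies between 0 and m f, so its integral is 0. At each point of [K] it
    equals [g] for large m, and dominated convergence concludes. *)
Lemma charge_integral_vanishing_ge0 (f g : 'rV[R]_n -> R) : (tv_norm K nu <= (I (cst 1))%:E)%E ->
  continuous f -> (forall x, K x -> 0 <= f x) -> I f = 0 ->
  continuous g -> (forall x, K x -> 0 <= g x) ->
  (forall x, K x -> f x = 0 -> g x = 0) -> I g = 0.
Proof.
move=> tvI cf f0 If cg g0 fg; have cwg : {within K, continuous g} by exact: continuous_subspaceT.
have [C C0 gC] := continuous_compact_bounded cK cwg.
pose h m x := Num.min (m%:R * f x) (g x).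
have cmf m : continuous (fun x => m%:R * f x) by exact: continuous_scale.
have ch m : continuous (h m).
  by move=> x; apply: (@continuous_min R _ (fun x => m%:R * f x) g); [exact: cmf|exact: cg].
have h0 m x : K x -> 0 <= h m x.
  by move=> Kx; rewrite le_min g0 // mulr_ge0 // f0.
have Ih m : I (h m) = 0.
  apply/eqP; rewrite eq_le (charge_integral_ge0 tvI (ch m) (h0 m)) andbT.
  have chN : continuous (fun x => -1 * h m x) by exact: continuous_scale.
  have : 0 <= I (fun x => m%:R * f x + -1 * h m x).
    apply: charge_integral_ge0 => // [|x Kx].
      exact: continuous_add.
    by rewrite mulN1r subr_ge0 ge_min lexx.
  rewrite charge_integralD; try exact: continuous_subspaceT.
  rewrite !charge_integralZ; try exact: continuous_subspaceT.
  by rewrite If mulr0 add0r mulN1r oppr_ge0.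
have hB m x : K x -> `|h m x| <= C.
  move=> Kx; rewrite ger0_norm ?h0 //; apply: le_trans (gC x Kx).
  by rewrite ger0_norm ?g0 // ge_min lexx orbT.
have hg x : K x -> \forall m \near \oo, h m x = g x.
  move=> Kx; have [fx0|fx0] := eqVneq (f x) 0.
    by apply: nearW => m; rewrite /h fx0 fg // mulr0 minxx.
  have fx : 0 < f x by rewrite lt_neqAle eq_sym fx0 f0.
  near=> m; rewrite /h; apply/min_idPr; rewrite -ler_pdivrMr //.
  by near: m; exact: nbhs_infty_ger.
have := charge_integral_cvg ch hB hg; under eq_fun do rewrite Ih.
by move=> /(cvg_lim (@norm_hausdorff _ _)) <-; rewrite lim_cst.
Unshelve. all: by end_near. Qed.

(** Expresses that [nu] lives on the zero set of [f]. The signed case follows from the positive and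
    negative parts of [g]. *)
Lemma charge_integral_vanishing (f g : 'rV[R]_n -> R) : (tv_norm K nu <= (I (cst 1))%:E)%E ->
  continuous f -> (forall x, K x -> 0 <= f x) -> I f = 0 ->
  continuous g -> (forall x, K x -> f x = 0 -> g x = 0) -> I g = 0.
Proof.
move=> tvI cf f0 If cg fg.
have cM (s : R) : continuous (fun x => Num.max (s * g x) 0).
  move=> x; apply: (@continuous_max R _ (fun x => s * g x) (cst 0));
    last exact: cst_continuous.
  exact: continuous_scale.
have IM (s : R) : I (fun x => Num.max (s * g x) 0) = 0.
  apply: (charge_integral_vanishing_ge0 tvI cf f0 If) => // x Kx.
    by rewrite le_max lexx orbT.
  by move=> /(fg x Kx) ->; rewrite mulr0 maxxx.
have cM1 : continuous (fun x => -1 * Num.max (-1 * g x) 0) by exact: continuous_scale.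
have -> : I g = I (fun x => Num.max (1 * g x) 0 + -1 * Num.max (-1 * g x) 0).
  apply: eq_charge_integral => x _.
  rewrite mul1r !mulN1r /Num.max; case: ltrP => ?; case: ltrP => ?; lra.
rewrite charge_integralD; try exact: continuous_subspaceT.
rewrite charge_integralZ; try exact: continuous_subspaceT.
by rewrite !IM mulr0 addr0.
Qed.

End ChargeIntegral.
End BorelRn.

(** * Charges determined by continuous functions, and atomic measures *)

Lemma closed_zero_set (R : realType) (V : normedModType R) (C : set V) :
  closed C -> exists h : V -> R,
    [/\ continuous h, forall x, 0 <= h x & forall x, C x <-> h x = 0].
Proof.
(* The function is the distance to [C]; it is infinite for the empty set, where the constant 1
   replaces it. *)
move=> cC; have [->|/set0P[c Cc]] := eqVneq C set0.
  exists (cst 1); split=> [||x]; [exact: cst_continuous|by move=> ?; exact: ler01|].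
  by split=> // /eqP; rewrite oner_eq0.
pose f : V -> \bar R := edist_inf C.
have ffin x : f x \is a fin_num.
  rewrite ge0_fin_numE ?edist_inf_ge0 //.
  apply: (@le_lt_trans _ _ (edist (x, c))).
    by apply: ereal_inf_lbound; exists c.
  rewrite -ge0_fin_numE ?edist_ge0 //; apply/edist_finP.
  exists (`|x - c| + 1) => /=; first by rewrite ltr_wpDl.
  by rewrite -ball_normE /= ltrDl.
exists (fine \o f); split=> [x|x|x].
- by apply: fine_cvg; rewrite /comp fineK //; exact: edist_inf_continuous.
- by rewrite /= fine_ge0 // edist_inf_ge0.
- split=> [Cx|fx0]; first by rewrite /= /f edist_inf0.
  have ex0 : edist_inf C x = 0%E.
    by rewrite -/(f x) -[f x]fineK //; congr EFin.
  rewrite (proj1 (closure_id C) cC) => B /nbhs_ballP[e e0 eB].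
  have [|_ [a Ca <-]] := @lb_ereal_inf_adherent _ [set edist (x, a) | a in C] _ e0.
    by rewrite -/(edist_inf C x) ex0.
  rewrite -/(edist_inf C x) ex0 add0e => /edist_lt_ball /= xa.
  by exists a; split => //; exact: eB.
Qed.

Section BorelRn.
Variables (R : realType) (n : nat).
Local Notation T := (borelRn R n).
Implicit Types (K C : set 'rV[R]_n) (g : 'rV[R]_n -> R).

Lemma charge_integral_indic (nu : {charge set T -> \bar R}) K C :
  compact K -> closed C -> concentrated K nu ->
  (charge_integral nu K \1_C)%:E = nu C.
Proof.
move=> cK cC nuK; have mK := borel_compact cK; have mC := borel_closed cC.
rewrite (nuK _ mC) /charge_integral /Rintegral !integral_indic //.
have mCK : measurable ((C : set T) `&` K) by exact: measurableI.
rewrite EFinB !fineK ?fin_num_measure //.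
rewrite [in RHS](jordan_decomp (svalP (hahn_pair nu)) mCK) /cadd /= cscaleN1.
by [].
Qed.

(** Closed sets are stable under intersection and generate the Borel sets. *)
Lemma eq_measure_closed (m1 m2 : {measure set T -> \bar R}) :
  (m1 setT < +oo)%E -> (forall C, closed C -> m1 C = m2 C) ->
  forall A : set T, measurable A -> m1 A = m2 A.
Proof.
move=> m1fin m12 A mA.
apply: (@g_sigma_algebra_measure_unique _ R T (@closed 'rV[R]_n) _
  (fun=> setT) _ _ m1 m2 _ _ _ A) => //.
- by move=> C; exact: borel_closed.
- by apply/seteqP; split=> // x _; exists 0%N.
- by move=> C D; exact: closedI.
- apply: (smallest_sub _ _ mA); first exact: smallest_sigma_algebra.
  move=> U oU; rewrite -[U]setCK -setTD; apply: sigma_algebraCD.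
  by apply: sub_sigma_algebra; exact: open_closedC.
Qed.

Lemma charge_eq_continuous (nu rho : {charge set T -> \bar R}) K : compact K ->
  concentrated K nu -> concentrated K rho ->
  (forall g, continuous g -> charge_integral nu K g = charge_integral rho K g) ->
  charge_eq nu rho.
Proof.
move=> cK nuK rhoK nurho.
have eq_closed C : closed C -> nu C = rho C.
  move=> cC; rewrite -!(charge_integral_indic cK cC) //; congr EFin.
  have [phi [cphi phi0 phiC]] := closed_zero_set cC.
  (* Continuous approximations of the indicator of [C]: equal to 1 on [C], and eventually 0 at each
     point outside. *)
  pose b m x := Num.max (1 + - m%:R * phi x) 0.
  have cb m : continuous (b m).
    move=> x; apply: (@continuous_max R _ (fun x => 1 + - m%:R * phi x) (cst 0));
      last exact: cst_continuous.
    apply: continuous_add; first exact: cst_continuous.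
    exact: continuous_scale.
  have bB m x : K x -> `|b m x| <= 1.
    move=> _; rewrite ger0_norm ?le_max ?lexx ?orbT // ge_max ler01 andbT.
    by rewrite mulNr gerBl mulr_ge0.
  have bC x : K x -> \forall m \near \oo, b m x = \1_C x.
    move=> _; rewrite indicE; have [/set_mem Cx|xC] := boolP (x \in C).
      by apply: nearW => m; rewrite /b (proj1 (phiC x) Cx) mulr0 addr0 max_l.
    have phix : 0 < phi x.
      rewrite lt_neqAle phi0 andbT eq_sym; apply: contra_notN (negP xC) => /eqP.
      by move=> /phiC; exact: mem_set.
    near=> m; rewrite /b; apply/max_idPr.
    rewrite mulNr subr_le0 -ler_pdivrMr //.
    by near: m; exact: nbhs_infty_ger.
  have l1 := @charge_integral_cvg _ _ nu _ cK _ _ _ cb bB bC.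
  have l2 := @charge_integral_cvg _ _ rho _ cK _ _ _ cb bB bC.
  have : charge_integral nu K \o b = charge_integral rho K \o b.
    by apply/funext => m; exact: nurho.
  move=> e12; move: l1; rewrite (_ : (fun m => _) = charge_integral rho K \o b) //.
  by move=> l1; exact: (cvg_unique (@norm_hausdorff _ _) l1 l2).
pose p1 : {measure set T -> \bar R} := jordan_pos (svalP (hahn_pair nu)).
pose n1 : {measure set T -> \bar R} := jordan_neg (svalP (hahn_pair nu)).
pose p2 : {measure set T -> \bar R} := jordan_pos (svalP (hahn_pair rho)).
pose n2 : {measure set T -> \bar R} := jordan_neg (svalP (hahn_pair rho)).
have nuE (A : set T) : measurable A -> nu A = (p1 A - n1 A)%E.
  by move=> mA; rewrite (jordan_decomp (svalP (hahn_pair nu)) mA) /cadd /= cscaleN1.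
have rhoE (A : set T) : measurable A -> rho A = (p2 A - n2 A)%E.
  by move=> mA; rewrite (jordan_decomp (svalP (hahn_pair rho)) mA) /cadd /= cscaleN1.
have fin (m : {finite_measure set T -> \bar R}) (A : set T) : measurable A -> m A \is a fin_num.
  by move=> mA; exact: fin_num_measure.
(* Uniqueness from closed sets is available for measures; moving the negative parts across turns an
   equality of charges into one of measures. *)
have key (A : set T) : measurable A ->
    (nu A == rho A) = (measure_add p1 n2 A == measure_add p2 n1 A).
  move=> mA; rewrite nuE // rhoE // !measure_addE.
  have : p1 A \is a fin_num by exact: fin.
  have : n1 A \is a fin_num by exact: fin.
  have : p2 A \is a fin_num by exact: fin.
  have : n2 A \is a fin_num by exact: fin.
  move: (p1 A) (n1 A) (p2 A) (n2 A) => [a| |] [b| |] [c| |] [d| |] // _ _ _ _.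
  by apply/eqP/eqP => -[H]; congr EFin; lra.
move=> A mA; apply/eqP; rewrite key //; apply/eqP.
have lt_oo : (measure_add p1 n2 setT < +oo)%E.
  by rewrite measure_addE lte_add_pinfty // ltey_eq fin.
apply: (eq_measure_closed lt_oo) => //.
move=> C cC; apply/eqP; rewrite -key; last exact: borel_closed.
exact/eqP/eq_closed.
Unshelve. all: by end_near. Qed.

(** Whichever Hahn decomposition was chosen, [mu] is both nonpositive and nonnegative on subsets of
    its negative set, so the negative part is zero and the positive part is [mu]. *)
Lemma charge_integral_measure (mu : {finite_measure set T -> \bar R}) K g :
  charge_integral (charge_of_finite_measure mu) K g =
  \int[mu]_(x in (K : set T)) g x.
Proof.
pose nu : {charge set T -> \bar R} := charge_of_finite_measure mu.
rewrite /charge_integral.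
set PN := hahn_pair _; have [_ [mN negN] _ _] := svalP PN.
have negE (A : set T) : measurable A -> jordan_neg (svalP PN) A = 0%E.
  move=> mA; rewrite jordan_negE cjordan_negE /crestr0 mem_set // /crestr.
  have -> : nu (A `&` (sval PN).2) = 0%E; last by rewrite oppe0.
  apply/eqP; rewrite eq_le negN //; last exact: measurableI.
  exact: measure_ge0.
have posE (A : set T) : measurable A -> jordan_pos (svalP PN) A = mu A.
  move=> mA; have : nu A = (jordan_pos (svalP PN) A - jordan_neg (svalP PN) A)%E.
    by rewrite (jordan_decomp (svalP PN) mA) /cadd /= cscaleN1.
  by rewrite negE // sube0 => <-.
rewrite /Rintegral (@eq_measure_integral _ _ _ _ mzero (jordan_neg _)); last first.
  by move=> A mA _; exact: negE.
rewrite integral_measure_zero subr0; congr fine.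
by apply: eq_measure_integral => A mA _; exact: posE.
Qed.

(** The sum runs over indices and not over a set, so the points may coincide; perturbed points can
    then be handled before they are known to be distinct. *)
Definition atomic (k : nat) (y : 'I_k -> 'rV[R]_n) (c : 'I_k -> R)
    (mu : set T -> \bar R) : Prop :=
  forall A : set T, measurable A ->
    mu A = (\sum_i (c i)%:E * \d_(y i : T) A)%E.

Lemma atomic_exists (k : nat) (y : 'I_k -> 'rV[R]_n) (c : 'I_k -> R) :
  (forall i, 0 <= c i) ->
  exists mu : {finite_measure set T -> \bar R}, atomic y c mu.
Proof.
(* [msum] takes a sequence indexed by [nat]; indices from [k] on get the zero measure. *)
move=> c0; pose m_ (j : nat) : {measure set T -> \bar R} :=
  if insub j is Some i then mscale (NngNum (c0 i)) (\d_(y i : T)) else mzero.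
have mE (A : set T) : msum m_ k A = (\sum_i (c i)%:E * \d_(y i : T) A)%E.
  by apply: eq_bigr => i _; rewrite /m_ valK.
have mfin : fin_num_fun (msum m_ k).
  move=> A mA; rewrite mE; apply/sum_fin_numP => i _ _.
  by rewrite fin_numM // diracE.
pose F := Measure_isFinite.Build _ _ _ (msum m_ k) mfin.
pose mu : {finite_measure set T -> \bar R} := HB.pack (msum m_ k) F.
by exists mu => A mA; exact: mE.
Qed.

Section Atomic.
Variables (k : nat) (y : 'I_k -> 'rV[R]_n) (c : 'I_k -> R) (K : set 'rV[R]_n).
Hypotheses (c0 : forall i, 0 <= c i) (yK : forall i, K (y i)).

Lemma atomic_concentrated (mu : set T -> \bar R) (A : set T) :
  compact K -> atomic y c mu -> measurable A -> mu A = mu (A `&` K).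
Proof.
move=> cK muE mA; have mK := borel_compact cK.
rewrite !muE //; last exact: measurableI.
apply: eq_bigr => i _; congr (_ * _)%E; rewrite !diracE; congr (_%:R%:E).
by rewrite in_setI [_ \in K]mem_set ?andbT //; exact: yK.
Qed.

Lemma Rintegral_atomic (mu : {measure set T -> \bar R}) g :
  compact K -> atomic y c mu -> {within K, continuous g} ->
  \int[mu]_(x in (K : set T)) g x = \sum_i c i * g (y i).
Proof.
move=> cK muE cg; have mK := borel_compact cK.
have mg := within_continuous_measurable cK cg.
pose m_ (j : nat) : {measure set T -> \bar R} :=
  if insub j is Some i then mscale (NngNum (c0 i)) (\d_(y i : T)) else mzero.
(* Nonnegative integrands first; [g] is then split into its positive and negative parts. *)
have ge0E (f : T -> \bar R) : measurable_fun (K : set T) f ->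
    (forall x, K x -> 0 <= f x)%E ->
    (\int[mu]_(x in (K : set T)) f x = \sum_i (c i)%:E * f (y i))%E.
  move=> mf f0; rewrite (@eq_measure_integral _ _ _ _ (msum m_ k)).
    rewrite ge0_integral_measure_sum //; apply: eq_bigr => i _.
    rewrite /m_ valK ge0_integral_mscale // integral_dirac //=.
    by rewrite diracE mem_set ?mul1e //; exact: yK.
  move=> A mA _; rewrite muE //; apply: eq_bigr => i _.
  by rewrite /m_ valK.
have mEg : measurable_fun (K : set T) (fun x : T => (g x)%:E).
  exact/measurable_EFinP.
rewrite /Rintegral integralE !ge0E //.
- pose gp i := Num.max (g (y i)) 0; pose gn i := Num.max (- g (y i)) 0.
  rewrite (eq_bigr (fun i => (c i * gp i)%:E)); last first.
    by move=> i _; rewrite funeposE -EFin_max -EFinM.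
  rewrite [X in (_ - X)%E](eq_bigr (fun i => (c i * gn i)%:E)); last first.
    by move=> i _; rewrite funenegE -EFinN -EFin_max -EFinM.
  rewrite !sumEFin -EFinB /= -sumrB; apply: eq_bigr => i _.
  rewrite -mulrBr /gp /gn /Num.max; congr (_ * _).
  by case: ltrP => ?; case: ltrP => ?; lra.
- exact: measurable_funeneg.
- exact: measurable_funepos.
Qed.

End Atomic.

End BorelRn.

(** * Total variation minimizers *)

Section Recovery.
Variables (R : realType) (n : nat).
Local Notation T := (borelRn R n).

Lemma poly_fun_continuous (f : mpoly n R) (K : set 'rV[R]_n) :
  {within K, continuous (poly_fun f)}.
Proof. by apply: continuous_subspaceT; exact: meval_continuous. Qed.

Lemma poly_fun1 : poly_fun (1 : mpoly n R) = cst 1.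
Proof. by apply/funext => x; exact: meval1. Qed.

Lemma poly_le_deg1 (d : nat) : poly_le_deg d (1 : mpoly n R).
Proof. by rewrite /poly_le_deg /= msize1. Qed.

Section Atomic.
Variables (k : nat) (y : 'I_k -> 'rV[R]_n) (c : 'I_k -> R) (K : set 'rV[R]_n).
Hypotheses (c0 : forall i, 0 <= c i) (yK : forall i, K (y i)) (cK : compact K).

Lemma tv_norm_atomic (rho : {finite_measure set T -> \bar R}) :
  atomic y c rho ->
  (tv_norm K (charge_of_finite_measure rho) <= (\sum_i c i)%:E)%E.
Proof.
move=> rhoE; apply: ge_ereal_sup => _ [g [cg g1] <-].
rewrite charge_integral_measure (Rintegral_atomic c0 yK cK rhoE cg) lee_fin.
apply: ler_sum => i _; rewrite -[leRHS]mulr1 ler_wpM2l //.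
by rewrite (le_trans (ler_norm _)) // g1.
Qed.

Lemma feasible_mass (d : nat) (mu : {measure set T -> \bar R})
    (nu : {charge set T -> \bar R}) : atomic y c mu -> feasible K d mu nu ->
  charge_integral nu K (cst 1) = \sum_i c i.
Proof.
move=> muE [_ /(_ _ (poly_le_deg1 d))]; rewrite poly_fun1 => ->.
rewrite (Rintegral_atomic c0 yK cK muE).
  by apply: eq_bigr => i _; rewrite mulr1.
by apply: continuous_subspaceT; exact: cst_continuous.
Qed.

Lemma le_tv_norm_mass (nu : {charge set T -> \bar R}) :
  ((charge_integral nu K (cst 1))%:E <= tv_norm K nu)%E.
Proof.
apply: ereal_sup_ubound; exists (cst 1) => //; split; last by move=> x _; rewrite normr1.
by apply: continuous_subspaceT; exact: cst_continuous.
Qed.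

End Atomic.

(** The variation of [rho] is at most its mass, which is the mass of [mu] and of every feasible
    charge, and mass never exceeds variation. The case of equal points and weights shows that [mu]
    is itself a minimizer. *)
Lemma atomic_minimizer (k : nat) (x y : 'I_k -> 'rV[R]_n) (b c : 'I_k -> R)
    (K : set 'rV[R]_n) (d : nat) (mu : {measure set T -> \bar R})
    (rho : {finite_measure set T -> \bar R}) :
  compact K -> (forall i, 0 <= b i) -> (forall i, 0 <= c i) ->
  (forall i, K (x i)) -> (forall i, K (y i)) -> atomic x b mu -> atomic y c rho ->
  (forall f, poly_le_deg d f ->
    \sum_i c i * poly_fun f (y i) = \sum_i b i * poly_fun f (x i)) ->
  tv_minimizer K d mu (charge_of_finite_measure rho).
Proof.
move=> cK b0 c0 xK yK muE rhoE eqf; split.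
  split; first by move=> A mA; exact: (atomic_concentrated yK cK rhoE mA).
  move=> f fd; rewrite charge_integral_measure.
  rewrite (Rintegral_atomic c0 yK cK rhoE) ?(Rintegral_atomic b0 xK cK muE);
    try exact: poly_fun_continuous.
  exact: eqf.
move=> nu nuF; apply: le_trans (tv_norm_atomic c0 yK cK rhoE) _.
have := eqf _ (poly_le_deg1 d); rewrite poly_fun1.
under eq_bigr do rewrite mulr1; move=> ->.
under eq_bigr do rewrite mulr1.
rewrite -(feasible_mass b0 xK cK muE nuF); exact: le_tv_norm_mass.
Qed.

Lemma unique_recovery (k : nat) (x : 'I_k -> 'rV[R]_n) (c : 'I_k -> R)
    (K : set 'rV[R]_n) (d : nat) (mu : {measure set T -> \bar R}) (f : mpoly n R) :
  compact K -> (forall i, 0 <= c i) -> (forall i, K (x i)) -> atomic x c mu ->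
  poly_le_deg d f -> (forall z, K z -> 0 <= poly_fun f z) ->
  (forall z, poly_fun f z = 0 <-> exists i, z = x i) ->
  (forall v : 'I_k -> R, exists2 q, poly_le_deg d q &
    forall i, poly_fun q (x i) = v i) ->
  has_unique_minimizer K d mu.
Proof.
move=> cK c0 xK muE fd f0 fX interp.
have [rho rhoE] := atomic_exists x c0.
have minrho : tv_minimizer K d mu (charge_of_finite_measure rho).
  exact: (@atomic_minimizer k x x c c).
exists (charge_of_finite_measure rho) => // nu [[nuK nuF] numin].
have IE q : poly_le_deg d q ->
    charge_integral nu K (poly_fun q) = \sum_i c i * poly_fun q (x i).
  move=> qd; rewrite nuF // (Rintegral_atomic c0 xK cK muE) //.
  exact: poly_fun_continuous.
(* Comparison with [rho]: a minimizer has no more variation than mass, so it acts as a nonnegative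
   measure. *)
have tvI : (tv_norm K nu <= (charge_integral nu K (cst 1))%:E)%E.
  rewrite (feasible_mass c0 xK cK muE (conj nuK nuF)).
  by rewrite (le_trans (numin _ minrho.1)) //; exact: (tv_norm_atomic c0 xK cK).
have If : charge_integral nu K (poly_fun f) = 0.
  by rewrite IE // big1 // => i _; rewrite (proj2 (fX (x i))) ?mulr0 //; exists i.
apply: (charge_eq_continuous cK nuK minrho.1.1) => g cg.
rewrite charge_integral_measure (Rintegral_atomic c0 xK cK rhoE); last first.
  exact: continuous_subspaceT.
(* The difference of [g] and its interpolant [q] vanishes on the zeros of [f], hence integrates to 0
   against [nu]; the integral of [q] is prescribed by the moments. *)
have [q qd qv] := interp (fun i => g (x i)).
have cq : continuous (poly_fun q) by exact: meval_continuous.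
have : charge_integral nu K (fun z => g z + -1 * poly_fun q z) = 0.
  apply: (charge_integral_vanishing cK tvI _ f0 If).
  - exact: meval_continuous.
  - by apply: continuous_add => //; exact: continuous_scale.
  - by move=> z _ /fX[i ->]; rewrite qv mulN1r subrr.
rewrite charge_integralD //; try apply: continuous_subspaceT => //; last first.
  exact: continuous_scale.
rewrite charge_integralZ //; last exact: continuous_subspaceT.
rewrite IE // mulN1r => /eqP; rewrite subr_eq0 => /eqP ->.
by apply: eq_bigr => i _; rewrite qv.
Qed.

End Recovery.

(** * Degree bounds, nonnegative certificates and interpolation *)

Lemma meval_sum (R : nzRingType) (n : nat) (v : 'I_n -> R) (I : Type) (r : seq I)
    (P : pred I) (F : I -> mpoly n R) :
  meval v (\sum_(i <- r | P i) F i) = \sum_(i <- r | P i) meval v (F i).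
Proof. exact: (raddf_sum (meval v)). Qed.

Section Degree.
Variables (R : realType) (n : nat).
Implicit Types f g : mpoly n R.

Lemma poly_le_degD d f g : poly_le_deg d f -> poly_le_deg d g ->
  poly_le_deg d (f + g).
Proof.
by rewrite /poly_le_deg /= => fd gd; rewrite (leq_trans (msizeD_le _ _)) // geq_max fd.
Qed.

Lemma poly_le_degN d f : poly_le_deg d f -> poly_le_deg d (- f).
Proof. by rewrite /poly_le_deg /= msizeN. Qed.

Lemma poly_le_deg_sum d (I : Type) (r : seq I) (P : pred I) (F : I -> mpoly n R) :
  (forall i, P i -> poly_le_deg d (F i)) -> poly_le_deg d (\sum_(i <- r | P i) F i).
Proof.
move=> Fd; apply: big_ind => //; first by rewrite /poly_le_deg /= msize0.
exact: poly_le_degD.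
Qed.

Lemma poly_le_degM d1 d2 f g : poly_le_deg d1 f -> poly_le_deg d2 g ->
  poly_le_deg (d1 + d2) (f * g).
Proof.
have [->|f0] := eqVneq f 0; first by rewrite mul0r /poly_le_deg /= msize0.
have [->|g0] := eqVneq g 0; first by rewrite mulr0 /poly_le_deg /= msize0.
rewrite /poly_le_deg /= msizeM // => fd gd.
by have := leq_add fd gd; case: (_ + _)%N => //= m; rewrite addnS ltnS.
Qed.

Lemma poly_le_deg_leq d1 d2 f : (d1 <= d2)%N -> poly_le_deg d1 f ->
  poly_le_deg d2 f.
Proof. by rewrite /poly_le_deg /= => d12 /leq_trans; apply; rewrite ltnS. Qed.

Lemma poly_le_degZ d (a : R) f : poly_le_deg d f -> poly_le_deg d (a *: f).
Proof. by rewrite /poly_le_deg /=; apply: leq_trans; exact: msizeZ_le. Qed.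

End Degree.

(** At a zero of the sum of squares, the first square forces the [q i] to sum to 1, so some [q i] is
    nonzero there; the squares with factor [lin i l] then force every coordinate to agree with the
    i-th point. *)
Lemma nonneg_poly_with_zeros (R : realType) (n k e : nat) (p : 'M[R]_(k, n))
    (q : 'I_k -> mpoly n R) :
  (forall i, poly_le_deg e (q i)) ->
  (forall i j, poly_fun (q i) (row j p) = (i == j)%:R) ->
  exists f, [/\ poly_le_deg (2 * (e + 1)) f, forall z, 0 <= poly_fun f z &
    forall z, poly_fun f z = 0 <-> exists i, z = row i p].
Proof.
move=> qe qp; pose lin i l : mpoly n R := mpolyX R (mnm1 l) - mpolyC n (p i l).
pose S := 1 - \sum_i q i.
pose f := S * S + \sum_i \sum_l (lin i l * q i) * (lin i l * q i).
have fE z : poly_fun f z = (1 - \sum_i poly_fun (q i) z) ^+ 2 +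
    \sum_i \sum_l ((z 0 l - p i l) * poly_fun (q i) z) ^+ 2.
  rewrite /poly_fun /f mevalD mevalM mevalB meval1 !meval_sum expr2 /=.
  congr (_ + _); apply: eq_bigr => i _; rewrite meval_sum; apply: eq_bigr => l _.
  by rewrite !mevalM mevalB mevalXU mevalC expr2.
have sum0 (z : 'rV[R]_n) : 0 <= \sum_i \sum_l ((z 0 l - p i l) * poly_fun (q i) z) ^+ 2.
  by apply: sumr_ge0 => i _; apply: sumr_ge0 => l _; exact: sqr_ge0.
have lin1 i l : poly_le_deg 1 (lin i l).
  apply: poly_le_degD; first by rewrite /poly_le_deg /= msizeX mdeg1.
  by apply: poly_le_degN; rewrite /poly_le_deg /= msizeC; case: eqP.
have Se : poly_le_deg e S.
  apply: poly_le_degD; first exact: poly_le_deg1.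
  by apply: poly_le_degN; exact: poly_le_deg_sum.
exists f; split.
- apply: poly_le_degD.
    apply: (@poly_le_deg_leq _ _ (e + e));
      first by rewrite mul2n -addnn leq_add ?leq_addr.
    exact: poly_le_degM.
  apply: poly_le_deg_sum => i _; apply: poly_le_deg_sum => l _.
  apply: (@poly_le_deg_leq _ _ ((1 + e) + (1 + e)));
    first by rewrite mul2n -addnn (addnC e).
  by apply: poly_le_degM; apply: poly_le_degM.
- by move=> z; rewrite fE addr_ge0 // sqr_ge0.
- move=> z; split=> [/eqP|[j ->]].
    rewrite fE paddr_eq0 ?sqr_ge0 // sqrf_eq0 subr_eq0 => /andP[/eqP sum1 sq0].
    have [i qi] : exists i, poly_fun (q i) z != 0.
      apply/existsP; apply: contraT; rewrite negb_exists => /forallP q0.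
      move: sum1; rewrite big1 => [/eqP|i _]; first by rewrite oner_eq0.
      by apply/eqP; have := q0 i; rewrite negbK.
    exists i; apply/rowP => l; rewrite mxE; apply/eqP.
    move: sq0; rewrite psumr_eq0 => [/allP/(_ i)|j _]; last first.
      by apply: sumr_ge0 => ? _; exact: sqr_ge0.
    rewrite mem_index_enum => /(_ isT) /=.
    rewrite psumr_eq0 => [/allP/(_ l)|? _]; last exact: sqr_ge0.
    rewrite mem_index_enum => /(_ isT) /=.
    by rewrite sqrf_eq0 mulf_eq0 (negbTE qi) orbF subr_eq0.
  rewrite fE [X in 1 - X](bigD1 j) //= [X in 1 - (_ + X)]big1 => [|i ij].
    rewrite qp eqxx addr0 subrr expr0n add0r big1 // => i _; rewrite big1 // => l _.
    rewrite qp mxE; case: eqP => [->|_]; rewrite ?subrr ?mul0r ?mulr0 expr0n //.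
  by rewrite qp (negbTE ij).
Qed.

Lemma interpolation (R : realType) (n k e : nat) (p : 'M[R]_(k, n))
    (m : 'I_k -> multinom n) : (forall i, (mdeg (m i) <= e)%N) ->
  \det (\matrix_(i, j) meval (fun l => p i l) (mpolyX R (m j))) != 0 ->
  forall v : 'I_k -> R, exists2 q, poly_le_deg e q &
    forall i, poly_fun q (row i p) = v i.
Proof.
move=> me; set E := \matrix_(i, j) _ => detE v.
have uE : E \in unitmx by rewrite unitmxE unitfE.
pose a := invmx E *m \col_i v i.
exists (\sum_j a j 0 *: mpolyX R (m j)).
  apply: poly_le_deg_sum => j _; apply: poly_le_degZ.
  by rewrite /poly_le_deg /= msizeX ltnS.
move=> i; rewrite /poly_fun meval_sum.
have /matrixP/(_ i 0) : E *m a = \col_i v i by rewrite mulKVmx.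
rewrite !mxE => <-; apply: eq_bigr => j _; rewrite mevalZ mulrC; congr (_ * _).
by rewrite [RHS]mxE; apply: meval_eq => l; rewrite mxE.
Qed.

(** * Discrete measures on point sets and failure of uniqueness *)

Section PositiveDiscrete.
Variables (R : realType) (n k : nat) (p : 'M[R]_(k, n)).
Hypothesis pinj : injective (fun i : 'I_k => row i p).
Local Notation T := (borelRn R n).

Lemma sum_point_set (F : 'rV[R]_n -> \bar R) :
  (\sum_(x \in point_set p) F x = \sum_(i < k) F (row i p))%E.
Proof.
rewrite fsbig_image; last by move=> i j _ _; exact: pinj.
rewrite [RHS]fsbig_seq ?index_enum_uniq //; apply: eq_fsbigl.
by apply/seteqP; split=> i //= _; rewrite mem_index_enum.
Qed.

Lemma positive_discrete_atomic (mu : {measure set T -> \bar R}) :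
  positive_discrete (point_set p) mu <->
  exists2 c : 'I_k -> R, (forall i, 0 <= c i) & atomic (fun i => row i p) c mu.
Proof.
split=> [[c [c0 muE]]|[c c0 muE]].
  exists (fun i => c (row i p)) => [i|A mA]; first by apply: c0; exists i.
  by rewrite muE // sum_point_set.
(* Extends the weights from indices to all of space; by injectivity the sum at a point of the set
   has a single term. *)
exists (fun x => \sum_(i | row i p == x) c i); split=> [x _|A mA].
  exact: sumr_ge0.
rewrite muE // sum_point_set; apply: eq_bigr => i _.
by rewrite (eq_bigl (pred1 i)) ?big_pred1_eq // => j; rewrite (inj_eq pinj).
Qed.

End PositiveDiscrete.

Lemma atomic_set1 (R : realType) (n k : nat) (y : 'I_k -> 'rV[R]_n)
    (c : 'I_k -> R) (mu : set (borelRn R n) -> \bar R) (x : 'rV[R]_n) :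
  atomic y c mu -> mu [set x] = (\sum_(i | y i == x) c i)%:E.
Proof.
move=> ->; last exact: borel_set1.
rewrite -sumEFin [RHS]big_mkcond; apply: eq_bigr => i _.
rewrite diracE; case: eqP => [<-|yx]; first by rewrite mem_set // mule1.
by rewrite memNset ?mule0.
Qed.

Lemma near_row (R : realType) (n k : nat) (p : 'M[R]_(k, n)) (c : 'rV[R]_k)
    (i : 'I_k) (B : set 'rV[R]_n) : nbhs (row i p) B ->
  \forall z \near row_mx (mxvec p) c, B (row i (vec_mx (lsubmx z))).
Proof.
move=> /nbhs_ballP[e e0 eB]; apply/nbhs_ballP; exists e => // z.
rewrite -ball_normE /= => pz; apply: eB; rewrite -ball_normE /=.
apply: le_lt_trans pz; apply: rV_norm_le => // j.
apply: le_trans (rV_norm_ge _ (lshift k (mxvec_index i j))).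
by rewrite [X in _ <= `|X|]mxE row_mxEl mxvecE !mxE.
Qed.

(** The left side counts the moments up to degree [d], the right side the coordinates and weights.
    The fiber of the moment map through a generic pair of points and weights therefore contains
    other pairs arbitrarily close to it; points interior to [K] leave room for the move. *)
Lemma generic_nonuniqueness (R : realType) (n k d : nat) :
  ('C(n + d, n) < k * n.+1)%N ->
  exists2 D : mpoly (k * n) R, D != 0 & forall p : 'M[R]_(k, n),
    meval (fun l => mxvec p 0 l) D != 0 -> injective (fun i : 'I_k => row i p) ->
    forall (K : set 'rV[R]_n) (d' : nat), compact K -> point_set p `<=` interior K ->
    (d' <= d)%N ->
    ~ (forall mu : {measure set borelRn R n -> \bar R},
        positive_discrete (point_set p) mu -> has_unique_minimizer K d' mu).
Proof.
rewrite mulnS (addnC k) => ltdim; have [m minj mP] := enum_monomials n d.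
have /fin_all_exists[F FE] a := weighted_power_sum k (mpolyX R (m a)).
have [W W0 Wfib] := generic_fiber_not_isolated F ltdim.
have [c [D [c0 D0 DE]]] := specialize_last W0.
exists D => // p Dp pinj K d' cK pK dd' uniq.
pose z0 := row_mx (mxvec p) c; pose pt (z : 'rV[R]_(k * n + k)) := vec_mx (lsubmx z).
have z0W : meval (fun l => z0 0 l) W != 0 by rewrite -DE.
(* Conditions that persist near [z0]: the moved point stays in [K], it avoids the other original
   points, and its weight stays positive. *)
pose Q (i : 'I_k) := [set z | [/\ K (row i (pt z)),
  forall j, j != i -> row i (pt z) != row j p & 0 < rsubmx z 0 i]].
pose U := [set z | forall i, Q i z].
have z0U : nbhs z0 U.
  apply: (@filter_forall _ _ Q (nbhs z0)) => i.
  have nK : \forall z \near z0, K (row i (pt z)).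
    by apply: near_row; apply: pK; exists i.
  have npos : \forall z \near z0, 0 < rsubmx z 0 i.
    have cz : continuous (fun z : 'rV[R]_(k * n + k) => rsubmx z 0 i).
      have -> : (fun z : 'rV[R]_(k * n + k) => rsubmx z 0 i) =
          fun z => z 0 (rshift (k * n) i) by apply/funext => z; rewrite mxE.
      exact: coord_continuous.
    have /cvgr_gt := cz z0; apply.
    by rewrite row_mxKr.
  have nsep : \forall z \near z0, forall j, j != i -> row i (pt z) != row j p.
    apply: (@filter_forall _ _ (fun j z => j != i -> row i (pt z) != row j p)
      (nbhs z0)) => j; have [ji|ji] := eqVneq j i.
      by apply: nearW.
    have : \forall z \near z0, (~` [set row j p]) (row i (pt z)).
      apply: near_row; apply: open_nbhs_nbhs; split.
        by apply: closed_openC; apply: compact_closed => //; exact: compact_set1.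
      by move=> /pinj ij; rewrite ij eqxx in ji.
    by apply: filterS => z + _ => /eqP.
  near=> z; split; by near: z.
have [z [zU zz0 Fz]] := Wfib z0 z0W U z0U.
pose p' := pt z; pose c' := rsubmx z.
have zE : z = row_mx (mxvec p') c' by rewrite /p' /pt vec_mxK hsubmxK.
have c'0 i : 0 < c' 0 i by have [] := zU i.
have pK' i : K (row i p) by apply: interior_subset; apply: pK; exists i.
have p'K i : K (row i p') by have [] := zU i.
have momE f : poly_le_deg d' f ->
    \sum_i c' 0 i * poly_fun f (row i p') = \sum_i c 0 i * poly_fun f (row i p).
  move=> fd; rewrite (mpolyE f).
  have expand (s : 'rV[R]_k) (q : 'M[R]_(k, n)) : \sum_i s 0 i * poly_fun
      (\sum_(u <- msupp f) mcoeff u f *: mpolyX R u) (row i q) =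
      \sum_(u <- msupp f) mcoeff u f *
        \sum_i s 0 i * meval (fun j => q i j) (mpolyX R u).
    under eq_bigr do rewrite /poly_fun meval_sum mulr_sumr.
    rewrite exchange_big; apply: eq_bigr => u _; rewrite mulr_sumr.
    apply: eq_bigr => i _; rewrite mevalZ mulrCA; congr (_ * (_ * _)).
    by apply: meval_eq => j; rewrite mxE.
  (* Moments agree monomial by monomial, and each monomial of [f] has degree at most [d]. *)
  rewrite !expand; apply: eq_big_seq => u uf.
  have /mP[a <-] : (mdeg u <= d)%N.
    by have := leq_trans (msize_mdeg_lt uf) fd; rewrite ltnS => /leq_trans; apply.
  by rewrite -!FE -zE Fz.
have [mu muE] := atomic_exists (fun i => row i p) (fun i => ltW (c0 i)).
have [nu nuE] := atomic_exists (fun i => row i p') (fun i => ltW (c'0 i)).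
have mud : positive_discrete (point_set p) mu.
  by apply/positive_discrete_atomic => //; exists (c 0) => // i; exact: ltW.
have [om _ uni] := uniq mu mud.
have minmu : tv_minimizer K d' mu (charge_of_finite_measure mu).
  apply: (@atomic_minimizer R n k (fun i => row i p) (fun i => row i p) (c 0) (c 0)) => //.
  - by move=> i; exact: ltW.
  - by move=> i; exact: ltW.
have minnu : tv_minimizer K d' mu (charge_of_finite_measure nu).
  apply: (@atomic_minimizer R n k (fun i => row i p) (fun i => row i p') (c 0) (c' 0)) => //.
  - by move=> i; exact: ltW.
  - by move=> i; exact: ltW.
(* Uniqueness identifies both measures, so they have the same mass at every single point. *)
have munu (x : 'rV[R]_n) : \sum_(i | row i p' == x) c' 0 i = \sum_(i | row i p == x) c 0 i.
  apply: EFin_inj; rewrite -(atomic_set1 _ nuE) -(atomic_set1 _ muE).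
  have mx := @borel_set1 R n x.
  exact: (etrans (uni _ minnu _ mx) (esym (uni _ minmu _ mx))).
(* A moved point carries positive mass, so it is one of the original points, and by the separation
   in [Q] it is the one with the same index. *)
have pp' i : row i p' = row i p.
  have : 0 < \sum_(j | row j p' == row i p') c' 0 j.
    rewrite (bigD1 i) //= ltr_pwDl // sumr_ge0 // => j _; exact: ltW.
  rewrite munu; case: (pickP (fun j => row j p == row i p')) => [j /eqP ji _|none].
    have [_ sep _] := zU i; have [ij|/sep/eqP[]] := eqVneq j i.
      by rewrite -{2}ij ji.
    by rewrite ji.
  by rewrite big_pred0 ?ltxx.
have eqp : p' = p by apply/row_matrixP.
(* With the points equal, the masses at the distinct points give equal weights, contradicting
   [z != z0]. *)
case/eqP: zz0; rewrite zE /z0 eqp; congr row_mx; apply/rowP => i.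
have := munu (row i p); rewrite eqp.
have pI : (fun j => row j p == row i p) =1 pred1 i by move=> j; rewrite (inj_eq pinj).
by rewrite !(eq_bigl _ _ pI) !big_pred1_eq.
Unshelve. all: by end_near. Qed.

(** * Combination of the two bounds outside one hypersurface *)

Unset Implicit Arguments.

Theorem theorem1p3 (R : realType) (n k : nat) (hn : (1 <= n)%N) (hk : (1 <= k)%N)
    (e l : nat)
    (he : is_least (fun e' : nat => (k <= 'C(n + e', e'))%N) e)
    (hl : is_least (fun l' : nat =>
            (k%:R : R) <= (n.+1%:R)^-1 * ('C(n + l', n))%:R) l) :
  generic (fun p : 'M[R]_(k, n) =>
    forall K : set 'rV[R]_n, compact K -> point_set p `<=` K ->
      exists d : nat, [/\ is_uniqueness_degree K (point_set p) d,
        (d <= 2 * (e + 1))%N &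
        (point_set p `<=` interior K -> (l <= d)%N)]).
Proof.
(* By the choice of [e] there are at least [k] monomials of degree at most [e]; any [k] of them
   serve for interpolation. *)
have [m minj me] : exists2 m : 'I_k -> multinom n, injective m &
    forall i, (mdeg (m i) <= e)%N.
  have [m minj mP] := enum_monomials n e.
  have kN : (k <= 'C(n + e, n))%N.
    by have [+ _] := he; rewrite -bin_sub ?leq_addl // addnK.
  exists (m \o widen_ord kN).
    by move=> i j /minj /(congr1 val) /= ij; exact: val_inj.
  by move=> i; apply/mP; exists (widen_ord kN i).
have [D1 D10 D1E] := unisolvent_det R minj.
have [D2 D20 D2P] : exists2 D : mpoly (k * n) R, D != 0 & forall p : 'M[R]_(k, n),
    meval (fun j => mxvec p 0 j) D != 0 -> injective (fun i : 'I_k => row i p) ->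
    forall (K : set 'rV[R]_n) (d' : nat), compact K -> point_set p `<=` interior K ->
    (d' < l)%N ->
    ~ (forall mu : {measure set borelRn R n -> \bar R},
        positive_discrete (point_set p) mu -> has_unique_minimizer K d' mu).
  (* For [l = 0] there is no degree to exclude. Otherwise the minimality of [l] makes its inequality
     fail at [l.-1], which is the dimension count required for non-uniqueness in degrees up to
     [l.-1]. *)
  have [l0|l0] := posnP l; first by exists 1; rewrite ?oner_neq0 // l0.
  have [|D D0 DP] := @generic_nonuniqueness R n k l.-1.
    rewrite ltnNge; apply/negP => kl; have [_ /(_ l.-1)] := hl.
    rewrite mulrC ler_pdivlMr ?ltr0n // -natrM ler_nat => /(_ kl).
    by rewrite leqNgt ltn_predL l0.
  exists D => // p Dp pinj K d' cK pK d'l; apply: (DP p Dp pinj K d') => //.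
  by rewrite -ltnS prednK.
(* Outside this hypersurface [D1] gives interpolation for the upper bound and [D2] non-uniqueness
   for the lower one. *)
exists [set p | meval (fun j => mxvec p 0 j) (D1 * D2) = 0]; split.
- exists [set D1 * D2]; apply/seteqP; split=> p /=.
    by move=> Dp f ->.
  by apply.
- have [v _ Dv] := mpoly_nonzero_pos (mulf_neq0 D10 D20).
  apply/eqP => /seteqP[_ /(_ (vec_mx (\row_j v j)) I)] /= /eqP.
  rewrite vec_mxK (meval_eq (v2 := v)) ?(negbTE Dv) // => j.
  by rewrite mxE.
- move=> p /= /eqP; rewrite mevalM mulf_eq0 negb_or D1E => /andP[D1p D2p].
  have interp := interpolation me D1p.
  have [q qP] : exists q : 'I_k -> mpoly n R, forall i, poly_le_deg e (q i) /\
      forall j, poly_fun (q i) (row j p) = (i == j)%:R.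
    apply: (@fin_all_exists _ _ (fun i q => poly_le_deg e q /\
      forall j, poly_fun q (row j p) = (i == j)%:R)) => i.
    by have [q qe qv] := interp (fun j => (i == j)%:R); exists q.
  (* Interpolation separates the points: [q i] is 1 at index [i] and 0 at every other index. *)
  have pinj : injective (fun i : 'I_k => row i p).
    move=> i j /= ij; apply/eqP; have := (qP i).2 j.
    rewrite -ij (qP i).2 eqxx; case: (i == j) => // /eqP.
    by rewrite oner_eq0.
  split=> // K cK pK.
  have [f [fd f0 fX]] := nonneg_poly_with_zeros (fun i => (qP i).1) (fun i => (qP i).2).
  pose P d := forall mu : {measure set borelRn R n -> \bar R},
    positive_discrete (point_set p) mu -> has_unique_minimizer K d mu.
  have P2e : P (2 * (e + 1))%N.
    move=> mu /(positive_discrete_atomic pinj)[c c0 muE].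
    apply: (unique_recovery cK c0 _ muE fd) => // [i|v].
      by apply: pK; exists i.
    have [g ge gv] := interp v; exists g => //.
    by apply: poly_le_deg_leq ge; rewrite mulnDr mul2n -addnn -addnA leq_addr.
  (* Uniqueness in degree [2 * (e + 1)] provides the existence of a least degree as well as its
     upper bound. *)
  have exP : exists d, `[< P d >] by exists (2 * (e + 1))%N; exact/asboolP.
  case: (ex_minnP exP) => d /asboolP Pd dmin.
  exists d; split.
  + by split=> // j Pj; apply: dmin; exact/asboolP.
  + by apply: dmin; exact/asboolP.
  + move=> pKi; rewrite leqNgt; apply/negP => dl.
    exact: (D2P p D2p pinj K d).
Qed.
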